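(* Let $\eta_t(\omega)$ be the random walk in random environment built from $\delta\in(0,1/2)$, $\alpha>0$ and the i.i.d. vectors $(\xi_i,Y_i)$ as described in the context. Suppose $\mathbb{P}[\xi_1=1/2]=1$, $\mathbb{E}[Y_1]>0$, $\sigma^2\in(0,\infty)$ and $\alpha\in(0,1)$. Then, for $\mathbb{P}$-a.e. $\omega$, the stationary distribution $(\pi_n)_{n\in\mathbb{Z}^+}$ of the Markov chain $\eta_t(\omega)$ satisfies, as $n\to\infty$, $$\pi_n=\exp\left(-\left(\frac{4\mathbb{E}[Y_1]}{1-\alpha}\right)n^{1-\alpha}[1+o(1)]\right).$$
   Context: Environment. Fix $\delta\in(0,1/2)$ and $\alpha>0$. Let $(\xi_i,Y_i)$, $i\in\mathbb{N}=\{1,2,\dots\}$, be i.i.d. random vectors on a probability space $(\Omega,\mathcal{F},\mathbb{P})$ (with expectation $\mathbb{E}$ and variance $\mathrm{Var}$) such that $\mathbb{P}[\delta\le\xi_1\le 1-\delta]=1$ and $Y_1$ takes values in $[-1,1]$. Set $p_0=q_0=1/2$ and, for $n\ge1$, let $p_n$ be the truncation of $\xi_n+Y_nn^{-\alpha}$ to $[\delta/2,1-\delta/2]$, i.e. $p_n=\xi_n+Y_nn^{-\alpha}$ if this lies in $[\delta/2,1-\delta/2]$, $p_n=\delta/2$ if $\xi_n+Y_nn^{-\alpha}<\delta/2$, and $p_n=1-\delta/2$ if $\xi_n+Y_nn^{-\alpha}>1-\delta/2$; let $q_n=1-p_n$. The environment is $\omega=(p_0,p_1,p_2,\dots)$.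 Walk. Given $\omega$, $(\eta_t(\omega);t\in\mathbb{Z}^+)$, $\mathbb{Z}^+=\{0,1,2,\dots\}$, is the irreducible aperiodic Markov chain on $\mathbb{Z}^+$ with transition probabilities: from $n\ge1$, to $n-1$ with probability $p_n$ and to $n+1$ with probability $q_n$; from $0$, to $0$ with probability $p_0$ and to $1$ with probability $q_0$. It is known that under the hypotheses of the claim this chain is ergodic (positive recurrent) for $\mathbb{P}$-a.e. $\omega$, so it has a unique stationary distribution $(\pi_n)_{n\in\mathbb{Z}^+}$ (depending on $\omega$). Notation. $\sigma^2=\mathrm{Var}[Y_1]$. *)

(* Defs.v *)
From HB Require Import structures.
From mathcomp Require Import all_boot all_order all_algebra.
From mathcomp Require Import all_classical all_reals all_analysis.

Set Implicit Arguments.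
Unset Strict Implicit.
Unset Printing Implicit Defensive.

Import Order.TTheory GRing.Theory Num.Theory.
Import numFieldNormedType.Exports.

Local Open Scope classical_set_scope.
Local Open Scope ring_scope.

Section IID.
Context (d d' : measure_display) (T : measurableType d) (T' : measurableType d')
  (R : realType).
Implicit Types (P : probability T R) (I : set nat) (X : nat -> T -> T').

Definition mutually_independent P I X : Prop :=
  forall (s : seq nat) (A : nat -> set T'),
    uniq s -> [set` s] `<=` I -> (forall i, measurable (A i)) ->
    P (\bigcap_(i in [set` s]) (X i @^-1` A i)) =
    (\prod_(i <- s) P (X i @^-1` A i))%E.

Definition identically_distributed P I X : Prop :=
  forall i j (A : set T'), I i -> I j -> measurable A ->
    P (X i @^-1` A) = P (X j @^-1` A).

Definition iid P I X : Prop :=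
  mutually_independent P I X /\ identically_distributed P I X.

End IID.

Section Walk.
Context (R : realType).

Definition truncate (a b x : R) : R :=
  if x < a then a else if b < x then b else x.

(* The environment (p_n) built from one realization of the sequences xi and Y,
   whose terms of index 0 are not used. *)
Definition environment (delta alpha : R) (xi Y : nat -> R) (n : nat) : R :=
  if n == 0%N then 1 / 2
  else truncate (delta / 2) (1 - delta / 2) (xi n + Y n * n%:R `^ (- alpha)).

Definition transition (p : nat -> R) (i j : nat) : R :=
  if i is k.+1 then
    if j == k then p i else if j == k.+2 then 1 - p i else 0
  else
    if j == 0%N then p 0%N else if j == 1%N then 1 - p 0%N else 0.

Definition stationary_distribution (Q : nat -> nat -> R) (pi : nat -> R) : Prop :=
  [/\ forall i, 0 <= pi i,
      (\sum_(0 <= i <oo) (pi i)%:E = 1)%E &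
      forall j, (\sum_(0 <= i <oo) (pi i * Q i j)%:E = (pi j)%:E)%E].

End Walk.

(* Main.v *)
(* The chain is reversible, so its stationary weights are
   w_n = prod_(k < n) q_k / p_(k+1), and up to a bounded term - ln w_n is the
   sum of the ln (p_k / q_k) for 1 <= k <= n. Eventually p_k = 1/2 + Y_k k^-alpha,
   hence ln (p_k / q_k) = k^-alpha (4 Y_k + O(k^-alpha)). The strong law of large
   numbers for the Y_k transfers, by Abel summation, to averages with the
   decreasing weights k^-alpha, whose sum is equivalent to
   n^(1 - alpha) / (1 - alpha).
   The law of large numbers is obtained from second moments: along the squares
   j^2 the squared means have summable expectations, and bounded increments
   control the gaps between consecutive squares. *)
Require Import Defs.
From HB Require Import structures.
From mathcomp Require Import all_boot all_order all_algebra.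
From mathcomp Require Import all_classical all_reals all_analysis.
From mathcomp Require Import measurable_realfun ring lra zify.

Set Implicit Arguments.
Unset Strict Implicit.
Unset Printing Implicit Defensive.

Import Order.TTheory GRing.Theory Num.Theory.
Import numFieldNormedType.Exports.

Local Open Scope classical_set_scope.
Local Open Scope ring_scope.

(** * Weighted averages and elementary asymptotics *)

Section Analysis.
Context {R : realType}.
Implicit Types (a x : nat -> R) (n : nat).

Lemma sum_inv_sqr_le n : \sum_(k < n) (k.+1%:R ^+ 2)^-1 <= 2 :> R.
Proof.
case: n => [|n]; first by rewrite big_ord0.
(* The constant bound is not inductive; with the correction [n.+1%:R^-1] the induction step becomes
   the inequality 1 / (m + 1)^2 <= 1 / m - 1 / (m + 1). *)
suff : \sum_(k < n.+1) (k.+1%:R ^+ 2)^-1 <= 2 - n.+1%:R^-1 :> R.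
  by move=> /le_trans; apply; rewrite lerBlDr lerDl invr_ge0.
elim: n => [|n IHn]; first by rewrite big_ord_recr big_ord0 /=; lra.
rewrite big_ord_recr /=; apply: le_trans (lerD IHn (lexx _)) _.
have n0 : 0 < n.+1%:R :> R by rewrite ltr0n.
have n1 : n.+2%:R = n.+1%:R + 1 :> R by rewrite -natr1.
rewrite n1; set m : R := n.+1%:R in n0 *.
rewrite -subr_ge0 (_ : _ - _ = (m * (m + 1) ^+ 2)^-1); last by field; lra.
by rewrite invr_ge0 mulr_ge0 ?sqr_ge0// ltW.
Qed.

(* The bound is the exact value of the sum when all nonempty partial sums of [x] equal
   [e * k%:R + C], since Abel summation is monotone in the partial sums. *)
Lemma abel_sum_le a x (e C : R) n :
  (forall k, 0 <= a k) -> (forall k, a k.+1 <= a k) ->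
  (forall k, `|\sum_(i < k) x i| <= e * k%:R + C) ->
  `|\sum_(k < n.+1) a k * x k| <= e * (\sum_(k < n.+1) a k) + C * a 0%N.
Proof.
move=> a0 a_noninc sx.
(* Without its boundary term the weighted sum combines the partial sums of [x] with the nonnegative
   coefficients [a k - a k.+1]; the right-hand side is the same combination of their bounds. *)
have aux : `|\sum_(k < n.+1) a k * x k - a n * (\sum_(k < n.+1) x k)| <=
    e * (\sum_(k < n.+1) a k) + C * a 0%N - a n * (e * n.+1%:R + C).
  elim: n => [|n IHn].
    rewrite !big_ord_recr !big_ord0 /= !add0r subrr normr0 mulr1.
    by rewrite mulrDr (mulrC C) (mulrC e) subrr.
  rewrite big_ord_recr /= [\sum_(k < n.+2) x k]big_ord_recr /=.
  rewrite [\sum_(k < n.+2) a k]big_ord_recr /=.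
  set W := \sum_(k < n.+1) a k * x k in IHn *.
  set S := \sum_(k < n.+1) x k in IHn *.
  set A := \sum_(k < n.+1) a k in IHn *.
  rewrite (_ : _ - _ = W - a n * S + (a n - a n.+1) * S); last by ring.
  apply: le_trans (ler_normD _ _) _; rewrite normrM ger0_norm ?subr_ge0//.
  have h : (a n - a n.+1) * `|S| <= (a n - a n.+1) * (e * n.+1%:R + C).
    by apply: ler_wpM2l; rewrite ?subr_ge0// sx.
  apply: le_trans (lerD IHn h) _.
  by rewrite -(natr1 n.+1); lra.
have := ler_normD (\sum_(k < n.+1) a k * x k - a n * (\sum_(k < n.+1) x k))
  (a n * (\sum_(k < n.+1) x k)).
rewrite subrK => /le_trans; apply; apply: le_trans (lerD aux (lexx _)) _.
rewrite normrM (ger0_norm (a0 n)).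
by have := ler_wpM2l (a0 n) (sx n.+1); lra.
Qed.

(** The partial sums of [x - l] are at most [e / 2 * k + C], so Abel summation bounds the centred
    weighted sum by [e / 2] times the total weight plus a constant, which the diverging total weight
    absorbs. *)
Lemma weighted_cesaro a x (l : R) :
  (forall k, 0 <= a k) -> (forall k, a k.+1 <= a k) ->
  \sum_(k < n) a k @[n --> \oo] --> +oo ->
  (\sum_(k < n) x k) / n%:R @[n --> \oo] --> l ->
  (\sum_(k < n) a k * x k) / (\sum_(k < n) a k) @[n --> \oo] --> l.
Proof.
move=> a0 a_noninc a_oo xl.
apply/cvgrPdist_le => e e0.
have e2 : 0 < e / 2 by rewrite divr_gt0.
have [N _ Nx] := (@cvgrPdist_le _ _ _ _ _ _ _).1 xl _ e2.
pose y k := x k - l.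
pose C := \sum_(k < N) `|y k|.
have sy k : `|\sum_(i < k) y i| <= e / 2 * k%:R + C.
  have [Nk|kN] := leqP N k.
    have [->|k0] := posnP k; first by rewrite big_ord0 normr0 mulr0 add0r sumr_ge0.
    have k0' : 0 < k%:R :> R by rewrite ltr0n.
    have := Nx k Nk; rewrite /= distrC.
    rewrite -(ler_pM2r k0') -{2}(ger0_norm (ltW k0')) -normrM mulrBl divfK ?gt_eqF//.
    rewrite /y sumrB sumr_const card_ord -(mulr_natr l) => /le_trans; apply.
    by rewrite lerDl sumr_ge0.
  apply: le_trans (ler_norm_sum _ _ _) _.
  apply: (@le_trans _ _ C); last by rewrite lerDr mulr_ge0 ?ler0n// ltW.
  rewrite /C -!(big_mkord xpredT (fun i => `|y i|)).
  rewrite [leRHS](big_cat_nat (leq0n k) (ltnW kN))/=.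
  by rewrite lerDl; apply: sumr_ge0 => i _; exact: normr_ge0.
near=> n; rewrite distrC.
(* The quotient makes the total weight absorb [C * a 0]; the summand 1 makes it positive, hence a
   legitimate divisor. *)
have A_gt : 1 + C * a 0%N / (e / 2) <= \sum_(k < n) a k.
  by near: n; exact: ((@cvgryPge _ _ _ _ _).1 a_oo).
have Ca : 0 <= C * a 0%N by rewrite mulr_ge0// sumr_ge0.
have A0 : 0 < \sum_(k < n) a k.
  by apply: lt_le_trans A_gt; rewrite ltr_wpDr// divr_ge0// ltW.
have -> : (\sum_(k < n) a k * x k) / (\sum_(k < n) a k) - l =
    (\sum_(k < n) a k * y k) / (\sum_(k < n) a k).
  apply: (mulIf (lt0r_neq0 A0)); rewrite mulrBl !divfK ?gt_eqF// mulr_sumr -sumrB.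
  by apply: eq_bigr => k _; rewrite /y mulrBr (mulrC l).
rewrite normrM normfV (ger0_norm (ltW A0)) ler_pdivrMr//.
have {}A_gt : C * a 0%N <= e / 2 * \sum_(k < n) a k.
  rewrite -ler_pdivrMl// mulrC; apply: le_trans A_gt.
  by rewrite lerDr.
move: A_gt A0; case: (n) => [|m]; first by rewrite big_ord0 ltxx.
move=> A_gt _; apply: le_trans (abel_sum_le m a0 a_noninc sy) _.
lra.
Unshelve. all: by end_near. Qed.

(** Bernoulli's inequality for concave powers: Young's inequality with exponents 1 / b and 1 / (1 -
    b), applied to (1 + t)^b and 1. *)
Lemma powR1D_le (b t : R) : 0 < b < 1 -> -1 <= t -> (1 + t) `^ b <= 1 + b * t.
Proof.
move=> /andP[b0 b1] t1.
have t0 : 0 <= 1 + t by lra.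
have b1' : 0 < 1 - b by lra.
have := @conjugate_powR R ((1 + t) `^ b) 1 b^-1 (1 - b)^-1 (powR_ge0 _ _) ler01.
rewrite !invr_gt0 !invrK -powRrM mulfV ?gt_eqF// powRr1// powR1 mulr1.
by move=> /(_ b0 b1' (subrKC _ _)) /le_trans; apply; lra.
Qed.

Lemma powRn_cvgy (b : R) : 0 < b -> n%:R `^ b @[n --> \oo] --> +oo.
Proof.
move=> b0; apply/cvgryPge => M; near=> n.
have Mn : `|M| `^ b^-1 <= n%:R by near: n; exact: nbhs_infty_ger.
apply: le_trans (ler_norm M) _.
rewrite -[leLHS]powRr1// -[in leLHS](mulVf (lt0r_neq0 b0)) powRrM.
by apply: ge0_ler_powR => //; rewrite ?nnegrE ?powR_ge0// ltW.
Unshelve. all: by end_near. Qed.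

Lemma powRn_cvg0 (b : R) : 0 < b -> n%:R `^ (- b) @[n --> \oo] --> 0.
Proof.
move=> b0; under eq_cvg do rewrite powRN.
apply: ((@gtr0_cvgV0 _ _ _ _ (fun n : nat => n%:R `^ b) _).2 (powRn_cvgy b0)).
by near=> n; rewrite powR_gt0// ltr0n; near: n; exists 1%N.
Unshelve. all: by end_near. Qed.

Lemma powR_subr1 (b t : R) : 0 < t -> 0 < b -> t `^ (b - 1) = t `^ b / t.
Proof.
by move=> t0 b0; rewrite -(mulr_powRB1 (ltW t0) b0) mulrAC mulfV ?gt_eqF// mul1r.
Qed.

(** Bernoulli's inequality at t = -1 / (n + 1), multiplied by (n + 1)^b; the case n = 0 is the
    endpoint t = -1. *)
Lemma powR_succ_sub_le (b : R) n : 0 < b < 1 ->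
  b * n.+1%:R `^ (b - 1) <= n.+1%:R `^ b - n%:R `^ b.
Proof.
move=> b01; have n0 : 0 < n.+1%:R :> R by rewrite ltr0n.
have V1 : n.+1%:R^-1 <= 1 :> R by rewrite invf_le1// ler1n.
have -> : n%:R = n.+1%:R * (1 + - n.+1%:R^-1) :> R.
  by rewrite mulrDr mulrN mulfV ?gt_eqF// mulr1 -natr1 addrK.
rewrite powR_subr1//; last by case/andP: b01.
rewrite powRM ?(ltW n0) ?subr_ge0//.
have V2 : -1 <= - n.+1%:R^-1 :> R by rewrite lerN2.
have := ler_wpM2l (powR_ge0 n.+1%:R b) (powR1D_le b01 V2).
by set V := n.+1%:R^-1; set X := n.+1%:R `^ b; set Z := (1 + - V) `^ b; lra.
Qed.

Lemma powR_sub_succ_le (b : R) n : 0 < b < 1 ->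
  n.+2%:R `^ b - n.+1%:R `^ b <= b * n.+1%:R `^ (b - 1).
Proof.
move=> b01; have n0 : 0 < n.+1%:R :> R by rewrite ltr0n.
have V0 : 0 <= n.+1%:R^-1 :> R by rewrite invr_ge0 ltW.
have -> : n.+2%:R = n.+1%:R * (1 + n.+1%:R^-1) :> R.
  by rewrite mulrDr mulfV ?gt_eqF// mulr1 -[LHS]natr1.
rewrite powR_subr1//; last by case/andP: b01.
rewrite powRM ?(ltW n0) ?addr_ge0//.
have V1 : -1 <= n.+1%:R^-1 :> R by rewrite (le_trans _ V0)// lerN10.
have := ler_wpM2l (powR_ge0 n.+1%:R b) (powR1D_le b01 V1).
by set V := n.+1%:R^-1; set X := n.+1%:R `^ b; set Z := (1 + V) `^ b; lra.
Qed.

(** Telescoping the two increment bounds replaces the comparison of the sum with the integral of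
    t^(b - 1). *)
Lemma sum_powR_bounds (b : R) n : 0 < b < 1 ->
  n.+1%:R `^ b - 1 <= b * (\sum_(k < n) k.+1%:R `^ (b - 1)) <= n%:R `^ b.
Proof.
move=> b01; have b0 : b != 0 by rewrite gt_eqF//; case/andP: b01.
elim: n => [|n /andP[IH1 IH2]].
  by rewrite big_ord0 mulr0 powR1 subrr powR0// lexx.
rewrite big_ord_recr /= mulrDr; apply/andP; split.
  by have := powR_sub_succ_le n b01; lra.
by have := powR_succ_sub_le n b01; lra.
Qed.

Lemma sum_powR_equiv (b : R) : 0 < b < 1 ->
  (\sum_(k < n) k.+1%:R `^ (b - 1)) / n%:R `^ b @[n --> \oo] --> b^-1.
Proof.
move=> b01; have b0 : 0 < b by case/andP: b01.
have lo : b^-1 * (1 - n%:R `^ (- b)) @[n --> \oo] --> b^-1.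
  rewrite -[X in _ --> X]mulr1 -[X in _ * X]subr0.
  by apply: cvgM; [exact: cvg_cst|apply: cvgB; [exact: cvg_cst|exact: powRn_cvg0]].
apply: (squeeze_cvgr _ lo (cvg_cst b^-1)).
near=> n.
have n0 : 0 < n%:R :> R by rewrite ltr0n; near: n; exists 1%N.
have nb0 : 0 < n%:R `^ b by rewrite powR_gt0.
have /andP[h1 h2] := sum_powR_bounds n b01.
rewrite ler_pdivrMr// ler_pdivlMr// -mulrA mulrBl mul1r powRN mulVf ?gt_eqF//.
rewrite !(mulrC b^-1) ler_pdivlMr// ler_pdivrMr// !(mulrC _ b) h2 andbT.
apply: le_trans h1; rewrite lerB// ge0_ler_powR ?nnegrE ?ler0n//; first exact: ltW.
by rewrite ler_nat.
Unshelve. all: by end_near. Qed.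

(** The bound ln (1 + t) <= t, applied also to the inverse of 1 + t, encloses ln (1 + t) between t /
    (1 + t) and t, whose gap is t^2 / (1 + t). *)
Lemma dist_ln1D_le (t : R) : `|t| <= 1 / 2 -> `|ln (1 + t) - t| <= 2 * t ^+ 2.
Proof.
move=> /[dup] t2; rewrite ler_norml => /andP[h1 h2].
have t0 : 0 < 1 + t by lra.
have up : ln (1 + t) <= t by apply: le_ln1Dx; lra.
have low : t / (1 + t) <= ln (1 + t).
  rewrite -lerN2 -lnV ?posrE// (_ : - (t / (1 + t)) = (1 + t)^-1 - 1); last by field; lra.
  rewrite -{1}[(1 + t)^-1](subrKC 1); apply: le_ln1Dx.
  by rewrite ltrBrDl subrr invr_gt0.
rewrite ler0_norm ?subr_le0// opprB.
apply: (@le_trans _ _ (t - t / (1 + t))); first by rewrite lerB.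
rewrite (_ : t - _ = t ^+ 2 / (1 + t)); last by field; lra.
rewrite ler_pdivrMr// mulrC mulrA ler_peMl ?sqr_ge0//; lra.
Qed.

(** The odds equal (1 + 2u) / (1 - 2u), and each of the two logarithms contributes an error of at
    most 8u^2. *)
Lemma dist_ln_odds_le (u : R) : `|u| <= 1 / 4 ->
  `|ln ((1 / 2 + u) / (1 - (1 / 2 + u))) - 4 * u| <= 16 * u ^+ 2.
Proof.
move=> /[dup] u4; rewrite ler_norml => /andP[h1 h2].
rewrite (_ : _ / _ = (1 + 2 * u) / (1 + - (2 * u))); last by field; lra.
rewrite ln_div ?posrE; [|lra|lra].
have h3 : `|2 * u| <= 1 / 2 by rewrite ler_norml; lra.
have h4 := dist_ln1D_le h3.
have h5 : `|ln (1 + - (2 * u)) - - (2 * u)| <= 2 * (- (2 * u)) ^+ 2.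
  by apply: dist_ln1D_le; rewrite normrN.
rewrite (_ : _ - _ = (ln (1 + 2 * u) - 2 * u) -
  (ln (1 + - (2 * u)) - - (2 * u))); last by ring.
apply: le_trans (ler_normB _ _) _; apply: le_trans (lerD h4 h5) _.
by rewrite le_eqVlt; apply/orP; left; apply/eqP; ring.
Qed.

End Analysis.

(** * Stationary distributions of birth-death chains *)

Section BirthDeath.
Context {R : realType}.
Implicit Types (p pi : nat -> R).

(** The solution of the detailed balance equations with value 1 at state 0. *)
Definition birth_death_weight p (n : nat) : R :=
  \prod_(k < n) ((1 - p k) / p k.+1).

Lemma eseries_finite_support (f : nat -> R) (N : nat) :
  (forall i, 0 <= f i) -> (forall i, (N <= i)%N -> f i = 0) ->
  (\sum_(0 <= i <oo) (f i)%:E = (\sum_(i < N) f i)%:E)%E.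
Proof.
move=> f0 fN; rewrite (@nneseries_split _ _ 0%N N); last by move=> k _; rewrite lee_fin.
rewrite add0n eseries0 ?adde0; first by rewrite sumEFin big_mkord.
by move=> i Ni _; rewrite fN.
Qed.

Lemma transition_ge0 p i j : (forall n, 0 <= p n <= 1) -> 0 <= transition p i j.
Proof.
move=> p01; have q0 n : 0 <= 1 - p n by rewrite subr_ge0; case/andP: (p01 n).
have p0 n : 0 <= p n by case/andP: (p01 n).
by case: i => [|i] /=; case: ifP => // _; case: ifP.
Qed.

Lemma transition_eq0 p i j : (j.+1 < i)%N || (i.+1 < j)%N -> transition p i j = 0.
Proof.
by case: i => [|i] ij /=; (case: eqP => [?|_]; first by lia);
  (case: eqP => [?|//]; lia).
Qed.

(** Closed form of the j-th coordinate of [pi] times the transition matrix. At state 0 the holding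
    probability [p 0] takes the place of the missing left neighbour. *)
Definition inflow p pi (j : nat) : R :=
  (if j is k.+1 then pi k * (1 - p k) else pi 0%N * p 0%N) + pi j.+1 * p j.+1.

Lemma eseries_transition p pi (j : nat) :
  (forall n, 0 <= p n <= 1) -> (forall n, 0 <= pi n) ->
  (\sum_(0 <= i <oo) (pi i * transition p i j)%:E = (inflow p pi j)%:E)%E.
Proof.
move=> p01 pi0; rewrite (@eseries_finite_support _ j.+2); last 2 first.
- by move=> i; rewrite mulr_ge0// transition_ge0.
- by move=> i ji; rewrite transition_eq0 ?mulr0// ji.
congr (_%:E); case: j => [|j]; first by rewrite !big_ord_recr big_ord0 /= add0r.
have up : transition p j j.+1 = 1 - p j.
  by case: j => [//|j] /=; case: eqP => [?|_]; [lia|rewrite eqxx].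
have stay : transition p j.+1 j.+1 = 0.
  by rewrite /=; case: eqP => [?|_]; [lia|case: eqP => [?|//]; lia].
have down : transition p j.+2 j.+1 = p j.+2 by rewrite /= eqxx.
rewrite -(big_mkord xpredT (fun i => pi i * transition p i j.+1)).
rewrite !big_nat_recr// up stay down mulr0 big_mkord big1.
  by rewrite /= addr0 add0r.
by move=> i _; rewrite transition_eq0 ?mulr0//= !ltnS ltn_ord orbT.
Qed.

(** The net flow across each edge vanishes: this is stationarity at state 0 for the first edge, and
    stationarity at n + 1 passes it from one edge to the next. *)
Lemma stationary_distribution_detailed_balance p pi (n : nat) :
  (forall n, 0 <= p n <= 1) -> stationary_distribution (transition p) pi ->
  pi n.+1 * p n.+1 = pi n * (1 - p n).
Proof.
move=> p01 [pi0 _ stat].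
have {}stat j : inflow p pi j = pi j.
  by have := stat j; rewrite eseries_transition// => -[].
elim: n => [|n IHn]; first by have := stat 0%N; rewrite /inflow; lra.
by have := stat n.+1; rewrite /inflow; lra.
Qed.

Lemma birth_death_weight_balance p (n : nat) : p n.+1 != 0 ->
  birth_death_weight p n.+1 * p n.+1 = birth_death_weight p n * (1 - p n).
Proof.
by move=> pn; rewrite /birth_death_weight big_ord_recr /= -mulrA divfK.
Qed.

(** The normalized weights are reversible, hence stationary. Conversely detailed balance is a
    first-order recurrence, so any stationary distribution is a multiple of the weights, and total
    mass 1 fixes the multiple. *)
Lemma birth_death_stationary_distribution p :
  (forall n, 0 < p n <= 1) ->
  (\sum_(0 <= n <oo) (birth_death_weight p n)%:E < +oo)%E ->
  exists2 c : R, 0 < c &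
    unique (stationary_distribution (transition p))
      (fun n => c * birth_death_weight p n).
Proof.
move=> p01 w_lty; set w := birth_death_weight p in w_lty *.
have p0 n : p n != 0 by rewrite gt_eqF//; case/andP: (p01 n).
have p01' n : 0 <= p n <= 1 by case/andP: (p01 n) => /ltW -> ->.
have w0 n : 0 <= w n.
  rewrite /w /birth_death_weight prodr_ge0// => i _; apply: divr_ge0.
    by rewrite subr_ge0; case/andP: (p01 i).
  by case/andP: (p01' i.+1).
have w0E n : (0 <= (w n)%:E)%E by rewrite lee_fin.
set s := (\sum_(0 <= n <oo) (w n)%:E)%E in w_lty *.
have s1 : (1 <= s)%E.
  have := @nneseries_lim_ge _ (fun n => (w n)%:E) xpredT 0%N 1%N (fun n _ _ => w0E n).
  by rewrite big_nat1 {1}/w /birth_death_weight big_ord0.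
have sfin : s \is a fin_num.
  by rewrite ge0_fin_numE// (le_trans _ s1).
have s1' : 1 <= fine s by rewrite -lee_fin fineK.
have s0 : 0 < fine s by apply: lt_le_trans s1'.
exists (fine s)^-1; first by rewrite invr_gt0.
have w_balance n : w n.+1 * p n.+1 = w n * (1 - p n).
  exact: birth_death_weight_balance.
have cw0 n : 0 <= (fine s)^-1 * w n by rewrite mulr_ge0// invr_ge0 ltW.
have sumZ (c : R) : (\sum_(0 <= i <oo) (c * w i)%:E = (c * fine s)%:E)%E.
  under eq_eseriesr do rewrite EFinM.
  by rewrite nneseriesZl// EFinM fineK.
split.
  split => //; first by rewrite sumZ mulVf// gt_eqF.
  move=> j; rewrite eseries_transition//; congr (_%:E).
  rewrite /inflow; case: j => [|j]; rewrite -!mulrA -mulrDr; congr (_ * _).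
    by have := w_balance 0%N; lra.
  by have := w_balance j; have := w_balance j.+1; lra.
move=> pi' pi'_stat; have piE n : pi' n = pi' 0%N * w n.
  elim: n => [|n IHn]; first by rewrite /w /birth_death_weight big_ord0 mulr1.
  apply: (mulIf (p0 n.+1)).
  by rewrite (stationary_distribution_detailed_balance n p01' pi'_stat) -mulrA
    w_balance IHn mulrA.
case: pi'_stat => _ pi'_sum _.
have : (pi' 0%N * fine s)%:E = 1%E.
  by rewrite -sumZ -pi'_sum; apply: eq_eseriesr => i _; rewrite -piE.
move=> [] pi's; apply/funext => n; rewrite piE; congr (_ * _).
by apply: (mulIf (lt0r_neq0 s0)); rewrite mulVf ?gt_eqF.
Qed.

End BirthDeath.

(** * Logarithmic asymptotics of the stationary weights along a fixed environment *)

Section Asymptotics.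
Context {R : realType}.
Implicit Types (p x : nat -> R) (n : nat).

Lemma cesaro_mean (u : nat -> R) (l : R) : u n @[n --> \oo] --> l ->
  (\sum_(k < n) u k) / n%:R @[n --> \oo] --> l.
Proof.
move=> /cesaro ul; rewrite -cvg_shiftS.
apply: cvg_trans ul; apply: near_eq_cvg; apply: nearW => n /=.
by rewrite /arithmetic_mean /series /= big_mkord mulrC.
Qed.

(** Divided by its weight k^-alpha, each log-odds term is 4 x_k + o(1), so these quotients have
    Cesaro mean 4 mu. The weighted mean has the same limit, and the total weight is equivalent to
    n^(1 - alpha) / (1 - alpha). *)
Lemma sum_ln_odds_equiv (alpha mu : R) p x : 0 < alpha < 1 ->
  (forall k, `|x k| <= 1) ->
  (\forall k \near \oo, p k.+1 = 1 / 2 + x k * k.+1%:R `^ (- alpha)) ->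
  (\sum_(k < n) x k) / n%:R @[n --> \oo] --> mu ->
  (\sum_(k < n) ln (p k.+1 / (1 - p k.+1))) / n%:R `^ (1 - alpha)
    @[n --> \oo] --> 4 * mu / (1 - alpha).
Proof.
move=> /andP[al0 al1] x1 pE xmu.
pose b := 1 - alpha; have b01 : 0 < b < 1 by rewrite /b; lra.
have b0 : 0 < b by case/andP: b01.
have bE : b - 1 = - alpha by rewrite /b; ring.
pose a k : R := k.+1%:R `^ (- alpha).
have a_gt0 k : 0 < a k by rewrite powR_gt0// ltr0n.
have a_noninc k : a k.+1 <= a k.
  rewrite /a !powRN lef_pV2 ?posrE ?powR_gt0 ?ltr0n//.
  by rewrite ge0_ler_powR ?nnegrE ?ler0n ?ler_nat// ltW.
have a_cvg0 : a n @[n --> \oo] --> 0.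
  have := powRn_cvg0 al0; rewrite -(@cvg_shiftS _ (fun n => n%:R `^ (- alpha))).
  exact.
have sum_aE n : \sum_(k < n) a k = \sum_(k < n) k.+1%:R `^ (b - 1).
  by apply: eq_bigr => k _; rewrite bE.
have a_oo : \sum_(k < n) a k @[n --> \oo] --> +oo.
  apply/cvgryPge => M; near=> n.
  have /andP[+ _] := sum_powR_bounds n b01; rewrite -sum_aE.
  have : b * M + 1 <= n%:R `^ b by near: n; exact: (cvgryPge _).1 (powRn_cvgy b0) _.
  have : n%:R `^ b <= n.+1%:R `^ b.
    by rewrite ge0_ler_powR ?nnegrE ?ler0n ?ler_nat// ltW.
  by move=> h1 h2 h3; rewrite -(ler_pM2l b0); lra.
pose l k := ln (p k.+1 / (1 - p k.+1)).
pose y k := l k / a k.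
have yx0 : y n - 4 * x n @[n --> \oo] --> 0.
  apply/cvgrPdist_le => e e0; near=> k.
  have pk : p k.+1 = 1 / 2 + x k * a k by near: k.
  (* The bound 1 / 4 admits the log-odds estimate; [e / 16] turns its error [16 * a k ^+ 2] into at
     most [e * a k]. *)
  have ak : a k <= Num.min (1 / 4) (e / 16).
    near: k; apply: (cvgr_le _ a_cvg0).
    by rewrite lt_min !divr_gt0.
  move: ak; rewrite le_min => /andP[ak4 ake].
  have xak : `|x k * a k| <= 1 / 4.
    rewrite normrM (ger0_norm (ltW (a_gt0 k))); apply: le_trans ak4.
    by rewrite -[leRHS]mul1r ler_pM2r.
  have := dist_ln_odds_le xak; rewrite -pk -/(l k).
  rewrite sub0r normrN => h.
  rewrite (_ : y k - _ = (l k - 4 * (x k * a k)) / a k); last first.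
    by rewrite /y mulrBl mulrA mulfK ?gt_eqF.
  rewrite normrM normfV (ger0_norm (ltW (a_gt0 k))) ler_pdivrMr//.
  apply: (le_trans h); rewrite exprMn -real_normK ?num_real//.
  apply: (@le_trans _ _ (16 * a k ^+ 2)).
    by rewrite ler_pM2l// ler_piMl ?sqr_ge0// expr_le1.
  by rewrite expr2 mulrA ler_pM2r// mulrC -ler_pdivlMr.
have ymu : (\sum_(k < n) y k) / n%:R @[n --> \oo] --> 4 * mu.
  have : (\sum_(k < n) (y k - 4 * x k)) / n%:R + 4 * ((\sum_(k < n) x k) / n%:R)
      @[n --> \oo] --> 0 + 4 * mu.
    apply: cvgD; first exact: (cesaro_mean yx0).
    by apply: cvgM xmu; exact: cvg_cst.
  rewrite add0r; apply: cvg_trans; apply: near_eq_cvg; apply: nearW => n /=.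
  by rewrite sumrB -mulr_sumr; ring.
have := weighted_cesaro (fun k => ltW (a_gt0 k)) a_noninc a_oo ymu.
move=> /cvgM /(_ (sum_powR_equiv b01)).
apply: cvg_trans; apply: near_eq_cvg; near=> n => /=.
have A0 : 0 < \sum_(k < n) a k.
  by near: n; exact: (cvgryPgt _).1 a_oo _.
rewrite -sum_aE mulrA divfK ?gt_eqF//; congr (_ / _).
by apply: eq_bigr => k _; rewrite /y mulrC divfK ?gt_eqF.
Unshelve. all: by end_near. Qed.

(** Shifting the numerators by one index pairs each q_k with p_k and leaves the boundary factor q_0
    / q_n. *)
Lemma ln_birth_death_weight p n : (forall k, 0 < p k < 1) ->
  ln (birth_death_weight p n) =
  ln (1 - p 0%N) - ln (1 - p n) - \sum_(k < n) ln (p k.+1 / (1 - p k.+1)).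
Proof.
move=> p01; have p0 k : 0 < p k by case/andP: (p01 k).
have q0 k : 0 < 1 - p k by rewrite subr_gt0; case/andP: (p01 k).
have w0 m : 0 < birth_death_weight p m.
  by rewrite prodr_gt0// => k _; rewrite divr_gt0.
elim: n => [|n IHn].
  by rewrite /birth_death_weight !big_ord0 ln1 subr0 subrr.
rewrite /birth_death_weight big_ord_recr /= -/(birth_death_weight p n).
by rewrite lnM ?posrE ?divr_gt0// IHn big_ord_recr /= !ln_div ?posrE//; ring.
Qed.

Lemma nneseries_inv_sqr_le :
  (\sum_(0 <= k <oo) ((k.+1%:R ^+ 2)^-1)%:E <= (2 : R)%:E)%E.
Proof.
apply: lime_le.
  by apply: is_cvg_nneseries => k _ _; rewrite lee_fin invr_ge0 sqr_ge0.
by apply: nearW => n; rewrite sumEFin lee_fin big_mkord sum_inv_sqr_le.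
Qed.

(** Supplies the summability that normalization requires: eventually w_n <= exp (- (c / 2) n^b),
    which is O(n^-2). *)
Lemma nneseries_lty_of_ln (w : nat -> R) (b c : R) : 0 < b -> 0 < c ->
  (forall n, 0 < w n) ->
  ln (w n) / n%:R `^ b @[n --> \oo] --> - c ->
  (\sum_(0 <= n <oo) (w n)%:E < +oo)%E.
Proof.
move=> b0 c0 w0 lnw.
(* The term of degree [m.+1] of the exponential series already beats [n ^ 2]. *)
pose m := Num.bound (2 / b).
pose D := (c / 2) ^+ m.+1 / m.+1`!%:R.
have cm0 : 0 < (c / 2) ^+ m.+1 by rewrite exprn_gt0// divr_gt0.
have D0 : 0 < D by rewrite divr_gt0// ltr0n fact_gt0.
have bm : 2 <= b * m.+1%:R.
  rewrite mulrC -ler_pdivrMr//; apply/ltW.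
  have := @archi_boundP _ (2 / b); rewrite divr_ge0 ?ltW// => /(_ isT) /lt_le_trans.
  by apply; rewrite ler_nat.
(* The factor 4 pays for passing from n^2 to (n + 1)^2, since (n + 1)^2 <= 4 n^2 for n >= 1. *)
have [N _ Nw] : \forall n \near \oo, w n <= (D / 4)^-1 * (n.+1%:R ^+ 2)^-1.
  near=> n.
  have n0 : (0 < n)%N by near: n; exists 1%N.
  have n0' : 0 < n%:R :> R by rewrite ltr0n.
  have nb0 : 0 < n%:R `^ b :> R by rewrite powR_gt0.
  have : ln (w n) / n%:R `^ b <= - (c / 2).
    near: n; apply: (cvgr_le _ lnw).
    by rewrite ltrN2 ltr_pdivrMr// ltr_pMr// ltr1n.
  rewrite ler_pdivrMr// => h.
  pose X := c / 2 * n%:R `^ b.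
  have X0 : 0 <= X by rewrite mulr_ge0 ?ltW// divr_gt0.
  have wX : w n <= (expR X)^-1.
    by rewrite -expRN -[leLHS]lnK ?posrE// ler_expR /X -mulNr.
  have D4 : 0 < D / 4 by rewrite divr_gt0.
  have Dn : 0 < D / 4 * n.+1%:R ^+ 2 by rewrite mulr_gt0// exprn_gt0// ltr0n.
  apply: (le_trans wX); rewrite -invfM lef_pV2 ?posrE ?expR_gt0//.
  have eX := expR_ge1Dxn m X0.
  have : D * n%:R ^+ 2 <= X ^+ m.+1 / m.+1`!%:R.
    rewrite /X exprMn [leRHS]mulrAC (ler_pM2l D0).
    rewrite -(powR_mulrn _ (powR_ge0 n%:R b)) -powRrM -(powR_mulrn 2) ?ler0n//.
    by apply: ler_powR; rewrite // ler1n.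
  have : n.+1%:R ^+ 2 <= 4 * n%:R ^+ 2 :> R.
    have : 1 <= n%:R :> R by rewrite ler1n.
    rewrite -natr1; set z : R := n%:R => z1.
    rewrite -subr_ge0 (_ : _ - _ = (z - 1) * (3 * z + 1)); last by ring.
    by apply: mulr_ge0; lra.
  rewrite -(ler_pM2l D4) => /le_trans h2 h1; apply: h2.
  rewrite (_ : D / 4 * _ = D * n%:R ^+ 2); last by rewrite mulrA divfK.
  by apply: le_trans h1 _; apply: le_trans eX; rewrite lerDr.
rewrite (@nneseries_split _ _ 0%N N); last by move=> k _; rewrite lee_fin ltW.
rewrite add0n sumEFin lte_add_pinfty ?ltry//.
have v0 k : (0 <= ((k.+1%:R ^+ 2)^-1 : R)%:E)%E by rewrite lee_fin invr_ge0 sqr_ge0.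
have K0 : 0 <= (D / 4)^-1 by rewrite invr_ge0 divr_ge0 ?ltW.
rewrite -nneseries_addn; last by move=> k; rewrite lee_fin ltW.
apply: (@le_lt_trans _ _ (\sum_(0 <= k <oo) (((D / 4)^-1)%:E * ((k.+1%:R ^+ 2)^-1)%:E))%E).
  apply: lee_nneseries => [k _ _|k _]; first by rewrite lee_fin ltW.
  rewrite -EFinM lee_fin; apply: le_trans (Nw _ (leq_addl k N)) _.
  apply: ler_wpM2l => //.
  by rewrite lef_pV2 ?posrE ?exprn_gt0 ?ltr0n// lerXn2r ?nnegrE ?ler0n// ler_nat ltnS leq_addr.
rewrite nneseriesZl//; apply: le_lt_trans (ltry ((D / 4)^-1 * 2)).
by rewrite EFinM lee_wpmul2l ?lee_fin// nneseries_inv_sqr_le.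
Unshelve. all: by end_near. Qed.

Lemma truncate_id (lo hi z : R) : lo <= z <= hi -> truncate lo hi z = z.
Proof. by move=> /andP[h1 h2]; rewrite /truncate ltNge h1 /= ltNge h2. Qed.

Lemma truncate_itv (lo hi z : R) : lo <= hi -> lo <= truncate lo hi z <= hi.
Proof.
move=> lohi; rewrite /truncate; case: ltP => [_|h1]; first by rewrite lexx.
by case: ltP => [_|h2]; rewrite ?lexx ?lohi ?h1.
Qed.

(** The deterministic core: for one realization, the law of large numbers for [Y] is the only input
    left from probability. *)
Lemma environment_stationary_distribution (delta alpha mu : R) (xi Y : nat -> R) :
  0 < delta < 1 / 2 -> 0 < alpha < 1 -> 0 < mu ->
  (forall n, (1 <= n)%N -> xi n = 1 / 2) ->
  (forall n, (1 <= n)%N -> `|Y n| <= 1) ->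
  (\sum_(k < n) Y k.+1) / n%:R @[n --> \oo] --> mu ->
  exists pi : nat -> R,
    unique (stationary_distribution
      (transition (environment delta alpha xi Y))) pi /\
    exists eps : nat -> R, eps n @[n --> \oo] --> (0 : R) /\
      \forall n \near \oo,
        pi n = expR (- (4 * mu / (1 - alpha)
                        * n%:R `^ (1 - alpha) * (1 + eps n))).
Proof.
move=> /andP[d0 d1] al01 mu0 xiE Y1 Ymu.
have /andP[al0 al1] := al01.
set p := environment delta alpha xi Y.
have p_itv k : delta / 2 <= p k <= 1 - delta / 2.
  rewrite /p /environment; case: eqP => _; first by apply/andP; split; lra.
  by apply: truncate_itv; lra.
have p01 k : 0 < p k < 1 by have /andP[] := p_itv k; move=> *; apply/andP; split; lra.
have p0E : p 0%N = 1 / 2 by [].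
(* As [delta / 2 < 1 / 4], the truncation is inactive once k^-alpha <= 1 / 4. *)
have pE : \forall k \near \oo, p k.+1 = 1 / 2 + Y k.+1 * k.+1%:R `^ (- alpha).
  near=> k.
  have ak : k.+1%:R `^ (- alpha) <= 1 / 4 :> R.
    near: k.
    have : (k.+1%:R `^ (- alpha) : R) @[k --> \oo] --> 0.
      have := powRn_cvg0 al0; rewrite -(@cvg_shiftS _ (fun n => n%:R `^ (- alpha))).
      exact.
    by move=> /cvgr_le; apply; rewrite divr_gt0.
  have : `|Y k.+1 * k.+1%:R `^ (- alpha)| <= 1 / 4.
    rewrite normrM (ger0_norm (powR_ge0 _ _)); apply: le_trans ak.
    by rewrite ler_piMl ?powR_ge0// Y1.
  rewrite ler_norml => /andP[h1 h2].
  rewrite /p /environment /= xiE// truncate_id//.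
  by apply/andP; split; lra.
set b := 1 - alpha; have b0 : 0 < b by rewrite /b; lra.
set c := 4 * mu / b; have c0 : 0 < c by rewrite divr_gt0 ?mulr_gt0.
set w := birth_death_weight p.
have w0 n : 0 < w n.
  rewrite /w prodr_gt0// => k _; apply: divr_gt0.
    by rewrite subr_gt0; case/andP: (p01 k).
  by case/andP: (p01 k.+1).
have nb_cvg0 (u : nat -> R) (M : R) : (forall n, `|u n| <= M) ->
    u n / n%:R `^ b @[n --> \oo] --> 0.
  move=> uM; apply/cvgr0Pnorm_le => e e0; near=> n.
  have M0 : 0 <= M by apply: le_trans (uM 0%N).
  have n0 : (0 < n)%N by near: n; exists 1%N.
  have nb0 : 0 < n%:R `^ b :> R by rewrite powR_gt0// ltr0n.
  rewrite normrM normfV (ger0_norm (ltW nb0)) ler_pdivrMr//.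
  apply: le_trans (uM n) _; rewrite mulrC -ler_pdivrMr//.
  by near: n; exact: (cvgryPge _).1 (powRn_cvgy b0) _.
have lnw : ln (w n) / n%:R `^ b @[n --> \oo] --> - c.
  have := sum_ln_odds_equiv al01 (fun k => Y1 k.+1 isT) pE Ymu.
  rewrite -/b -/c => /cvgN.
  (* The truncation keeps 1 - p_n >= delta / 2, so the boundary term is bounded and vanishes after
     division by n^b. *)
  have := nb_cvg0 (fun n => ln (1 - p 0%N) - ln (1 - p n)) (- ln (1 - p 0%N) - ln (delta / 2)).
  move=> /(_ _) h /(cvgD (h _)) {h}; rewrite add0r => h.
  apply: cvg_trans (h _).
    apply: near_eq_cvg; apply: nearW => n /=.
    by rewrite /w ln_birth_death_weight// [RHS]mulrBl.
  move=> n.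
  have lq0 k : ln (1 - p k) <= 0 by apply: ln_le0; have /andP[] := p01 k; lra.
  have lq k : ln (delta / 2) <= ln (1 - p k).
    by rewrite ler_ln ?posrE; have /andP[] := p01 k; have /andP[] := p_itv k; lra.
  by rewrite ler_norml; have := lq0 0%N; have := lq0 n; have := lq n; have := lq 0%N; lra.
have w_lty := nneseries_lty_of_ln b0 c0 w0 lnw.
have [|K K0 pi_stat] := birth_death_stationary_distribution _ w_lty.
  by move=> k; case/andP: (p01 k) => -> /ltW.
exists (fun n => K * w n); split => //.
(* Obtained by solving the desired identity for [eps]; at n = 0 the division by zero gives -1,
   outside the range where the identity is claimed. *)
pose eps n := - (ln K + ln (w n)) / n%:R `^ b / c - 1.
exists eps; split.
  have : (ln K / n%:R `^ b + ln (w n) / n%:R `^ b) @[n --> \oo] --> 0 - c.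
    by apply: cvgD lnw; exact: (nb_cvg0 (fun=> ln K) `|ln K|).
  rewrite sub0r => /cvgN /cvgM /(_ (cvg_cst c^-1)) /cvgB /(_ (cvg_cst (1 : R))).
  rewrite opprK mulfV ?gt_eqF// subrr.
  apply: cvg_trans; apply: near_eq_cvg; apply: nearW => n /=.
  by rewrite /eps mulNr mulrDl.
near=> n.
have n0 : (0 < n)%N by near: n; exists 1%N.
have nb0 : 0 < n%:R `^ b :> R by rewrite powR_gt0// ltr0n.
rewrite (_ : - _ = ln K + ln (w n)); last by rewrite /eps; field; rewrite !gt_eqF.
by rewrite expRD !lnK ?posrE.
Unshelve. all: by end_near. Qed.

End Asymptotics.

(** * A law of large numbers *)

Lemma nat_sqrt_ex (n : nat) : exists j : nat, (j ^ 2 <= n < j.+1 ^ 2)%N.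
Proof.
elim: n => [|n [j /andP[h1 h2]]]; first by exists 0%N.
have [h|h] := ltnP n.+1 (j.+1 ^ 2).
  by exists j; rewrite h andbT ltnW.
by exists j.+1; rewrite h /=; apply: leq_ltn_trans h2 _; rewrite ltn_exp2r.
Qed.

(** If j^2 <= n < (j + 1)^2 then n - j^2 <= 2j, so s_n differs from s_(j^2) by at most 2Mj, which is
    negligible against j^2 <= n. *)
Lemma mean_cvg0_of_squares {R : realType} (s : nat -> R) (M : R) :
  (forall k, `|s k.+1 - s k| <= M) ->
  s (j ^ 2)%N / (j ^ 2)%:R @[j --> \oo] --> (0 : R) ->
  s n / n%:R @[n --> \oo] --> (0 : R).
Proof.
move=> s_lip s_sq.
have lip m k : `|s (m + k)%N - s m| <= M * k%:R.
  elim: k => [|k IHk]; first by rewrite addn0 subrr normr0 mulr0.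
  rewrite addnS -natr1 mulrDr mulr1.
  rewrite (_ : _ - _ = (s (m + k).+1 - s (m + k)%N) + (s (m + k)%N - s m)); last by ring.
  by apply: le_trans (ler_normD _ _) _; rewrite addrC lerD.
have M0 : 0 <= M by apply: le_trans (s_lip 0%N).
apply/cvgr0Pnorm_le => e e0.
have e2 : 0 < e / 2 by rewrite divr_gt0.
have [J _ sJ] := (@cvgr0Pnorm_le _ _ _ _ _ _).1 s_sq _ e2.
have [K _ MK] : \forall k \near \oo, 2 * M / (e / 2) <= k%:R by exact: nbhs_infty_ger.
exists ((J + K).+1 ^ 2)%N => // n /= Jn.
have [j /andP[jn nj]] := nat_sqrt_ex n.
have Jj : (J + K < j)%N.
  by rewrite -ltnS -(@ltn_exp2r _ _ 2)//; apply: leq_ltn_trans nj.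
have j0 : 0 < j%:R :> R by rewrite ltr0n (leq_ltn_trans _ Jj).
have j20 : 0 < (j ^ 2)%:R :> R by rewrite natrX exprn_gt0.
have n0 : 0 < n%:R :> R by apply: lt_le_trans j20 _; rewrite ler_nat.
have h1 : `|s (j ^ 2)%N| <= e / 2 * (j ^ 2)%:R.
  have := sJ j (ltnW (leq_ltn_trans (leq_addr K J) Jj)).
  by rewrite /= normrM normfV (ger0_norm (ltW j20)) ler_pdivrMr.
have h2 : `|s n - s (j ^ 2)%N| <= M * (2 * j%:R).
  rewrite -[in s n](subnKC jn); apply: le_trans (lip _ _) _.
  apply: ler_wpM2l => //; rewrite -natrM ler_nat; lia.
have h3 : 2 * M <= e / 2 * j%:R.
  have := MK j (ltnW (leq_ltn_trans (leq_addl J K) Jj)).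
  by rewrite /= ler_pdivrMr// (mulrC (e / 2)).
rewrite normrM normfV (ger0_norm (ltW n0)) ler_pdivrMr//.
rewrite -[s n](subrK (s (j ^ 2)%N)); apply: le_trans (ler_normD _ _) _.
have h4 : (j ^ 2)%:R <= n%:R :> R by rewrite ler_nat.
have h5 := ler_wpM2l (ltW e2) h4.
have h6 := ler_wpM2r (ltW j0) h3.
have h7 : (j ^ 2)%:R = j%:R * j%:R :> R by rewrite natrX expr2.
rewrite h7 in h1 h5; lra.
Qed.

Section LawOfLargeNumbers.
Context {d} {T : measurableType d} {R : realType} (P : probability T R).
Implicit Types (f : T -> R) (M : R).

Lemma bounded_integrable f M : measurable_fun setT f ->
  (forall w, `|f w| <= M) -> P.-integrable setT (EFin \o f).
Proof.
move=> mf fM; apply: measurable_bounded_integrable => //.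
  exact: le_lt_trans (probability_le1 P measurableT) (ltry 1).
exists M; split; first exact: num_real.
by move=> x Mx w _ /=; apply: le_trans (fM w) (ltW Mx).
Qed.

(** Independence makes the joint law agree with the product law on rectangles, hence everywhere;
    Fubini's theorem then splits the integral. *)
Lemma Rintegral_prod_independent (X Y : {RV P >-> R}) (M : R) :
  (forall w, `|X w| <= M) -> (forall w, `|Y w| <= M) ->
  (forall A B, measurable A -> measurable B ->
    P (X @^-1` A `&` Y @^-1` B) = P (X @^-1` A) * P (Y @^-1` B))%E ->
  \int[P]_w (X w * Y w) = \int[P]_w X w * \int[P]_w Y w.
Proof.
move=> XM YM indep.
have mX : measurable_fun setT X by [].
have mY : measurable_fun setT Y by [].
have mXY : measurable_fun setT (fun w => (X w, Y w)) by exact/measurable_fun_pairP.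
have iX : P.-integrable setT (EFin \o X) by apply: bounded_integrable mX XM.
have iY : P.-integrable setT (EFin \o Y) by apply: bounded_integrable mY YM.
pose m1 := distribution P X.
pose m2 := distribution P Y.
pose f : R * R -> \bar R := fun z => (z.1 * z.2 : R)%:E.
have mf : measurable_fun [set: R * R] f.
  by apply/measurable_EFinP; apply: measurable_funM.
have intf : P.-integrable setT (f \o (fun w => (X w, Y w))).
  apply: (@bounded_integrable (fun w => X w * Y w) (M * M)).
    exact: measurable_funM.
  by move=> w; rewrite normrM ler_pM.
pose XY' : {RV P >-> (R * R)%type} :=
  HB.pack (fun w => (X w, Y w)) (isMeasurableFun.Build _ _ _ _ _ mXY).
have prodE A : measurable A -> (m1 \x m2)%E A = distribution P XY' A.
  apply: product_measure_unique => /= B C mB mC.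
  exact: indep.
have intE (g : R * R -> \bar R) :
    (\int[(m1 \x m2)%E]_z g z = \int[distribution P XY']_z g z)%E.
  by apply: eq_measure_integral => A mA _; exact: prodE.
have if2 : (m1 \x m2)%E.-integrable setT f.
  have /integrableP[_ h] := integrable_pushforward mXY mf intf measurableT.
  by apply/integrableP; split => //; rewrite intE.
have E1 : (\int[P]_w (X w * Y w)%:E = \int[(m1 \x m2)%E]_z f z)%E.
  by rewrite intE integral_distribution.
rewrite /Rintegral E1 -integral12_prod_meas1// /fubini_F /f /=.
have iY2 : m2.-integrable setT EFin.
  by apply: integrable_pushforward => //; exact: measurable_EFin.
have iX2 : m1.-integrable setT EFin.
  by apply: integrable_pushforward => //; exact: measurable_EFin.
have EX : (\int[m1]_x x%:E = \int[P]_w (X w)%:E)%E.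
  by rewrite integral_distribution//; exact: measurable_EFin.
have EY : (\int[m2]_x x%:E = \int[P]_w (Y w)%:E)%E.
  by rewrite integral_distribution//; exact: measurable_EFin.
have EYfin : (\int[P]_w (Y w)%:E = (\int[P]_w Y w)%:E)%E.
  by rewrite /Rintegral fineK// integrable_fin_num.
under eq_integral => x _.
  under eq_integral => y _ do rewrite EFinM.
  rewrite integralZl// EY EYfin.
  over.
by rewrite integralZr// EX fineM// integrable_fin_num.
Qed.

Lemma ae_forall_nat (Q : nat -> T -> Prop) :
  (forall n, {ae P, forall w, Q n w}) -> {ae P, forall w n, Q n w}.
Proof.
move=> aeQ; apply: (@negligibleS _ _ _ _ (\bigcup_n ~` [set w | Q n w])).
  by move=> w /= /existsNP[n nQ]; exists n.
exact: negligible_bigcup.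
Qed.

Lemma probability1_ae (A : set T) : measurable A -> P A = 1%E ->
  {ae P, forall w, A w}.
Proof.
move=> mA PA; exists (~` A); split => //; first exact: measurableC.
by rewrite probability_setC// PA subee.
Qed.

(** Orthogonality gives E[S_n^2] <= M^2 n, so the squared means along the squares j^2 have
    expectations at most M^2 / j^2. Their sum is integrable, hence almost everywhere finite, and its
    terms tend to 0. *)
Lemma slln_bounded_orthogonal (D : nat -> T -> R) (M : R) :
  (forall i, measurable_fun setT (D i)) -> (forall i w, `|D i w| <= M) ->
  (forall i j, i != j -> \int[P]_w (D i w * D j w) = 0) ->
  {ae P, forall w, (\sum_(k < n) D k w) / n%:R @[n --> \oo] --> (0 : R)}.
Proof.
move=> mD DM orth.
pose S n w := \sum_(k < n) D k w.
have SS n w : S n.+1 w = S n w + D n w by rewrite /S big_ord_recr.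
have mS n : measurable_fun setT (S n) by apply: measurable_sum => i.
have SM n w : `|S n w| <= M *+ n.
  rewrite -[in M *+ n](card_ord n) -sumr_const.
  by apply: le_trans (ler_norm_sum _ _ _) _; apply: ler_sum => i _.
have iSD n m : P.-integrable setT (EFin \o (fun w => S n w * D m w)).
  apply: (@bounded_integrable _ (M *+ n * M)); first exact: measurable_funM.
  by move=> w; rewrite normrM ler_pM.
have iDD n m : P.-integrable setT (EFin \o (fun w => D n w * D m w)).
  apply: (@bounded_integrable _ (M * M)); first exact: measurable_funM.
  by move=> w; rewrite normrM ler_pM.
have iSS n m : P.-integrable setT (EFin \o (fun w => S n w * S m w)).
  apply: (@bounded_integrable _ (M *+ n * (M *+ m))); first exact: measurable_funM.
  by move=> w; rewrite normrM ler_pM.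
(* [S n] involves only the terms of index below n, so [D m] is orthogonal to it; this removes the
   cross terms of [S n.+1] squared. *)
have SD0 n m : (n <= m)%N -> \int[P]_w (S n w * D m w) = 0.
  elim: n => [_|n IHn nm].
    under eq_Rintegral do rewrite /S big_ord0 mul0r.
    by rewrite Rintegral_cst// mul0r.
  under eq_Rintegral do rewrite SS mulrDl.
  by rewrite RintegralD// (IHn (ltnW nm)) add0r orth// ltn_eqF.
have DD n : \int[P]_w (D n w * D n w) <= M * M.
  have -> : M * M = \int[P]_w (M * M).
    rewrite Rintegral_cst// [fine _](_ : _ = 1) ?mulr1//.
    exact: (congr1 fine (probability_setT P)).
  apply: le_Rintegral => //.
    exact: (@bounded_integrable _ `|M * M|).
  by move=> w _; rewrite -[leLHS]ger0_norm -?expr2 ?sqr_ge0// expr2 normrM ler_pM.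
have ES2 n : \int[P]_w (S n w * S n w) <= M * M * n%:R.
  elim: n => [|n IHn].
    under eq_Rintegral do rewrite /S big_ord0 mul0r.
    by rewrite Rintegral_cst// mul0r mulr0.
  under eq_Rintegral do rewrite [X in _ * X]SS mulrDr.
  rewrite RintegralD//.
  under eq_Rintegral do rewrite SS mulrDl.
  under [X in _ + X]eq_Rintegral do rewrite SS mulrDl.
  rewrite !RintegralD//; last by under eq_fun do rewrite mulrC.
  rewrite SD0// add0r; under [X in _ + X + _]eq_Rintegral do rewrite mulrC.
  by rewrite SD0// addr0 -natr1 mulrDr mulr1 lerD.
(* The squared mean at time (j + 1)^2; the shift avoids dividing by zero. *)
pose g j w : R := ((j.+1 ^ 2)%:R ^+ 2)^-1 * (S (j.+1 ^ 2)%N w * S (j.+1 ^ 2)%N w).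
have mg j : measurable_fun setT (g j).
  by apply: measurable_funM => //; exact: measurable_funM.
have g0 j w : 0 <= g j w.
  by rewrite mulr_ge0 ?invr_ge0 ?sqr_ge0// -expr2 sqr_ge0.
have Eg j : (\int[P]_w (g j w)%:E <= (M * M)%:E * ((j.+1%:R ^+ 2)^-1)%:E)%E.
  pose c : R := ((j.+1 ^ 2)%:R ^+ 2)^-1.
  have c0 : 0 <= c by rewrite invr_ge0 sqr_ge0.
  rewrite -[leLHS]fineK; last first.
    apply: integrable_fin_num => //.
    apply: (@bounded_integrable _ (c * (M *+ (j.+1 ^ 2) * (M *+ (j.+1 ^ 2))))) => // w.
    by rewrite /g normrM ger0_norm// ler_wpM2l// normrM ler_pM.
  rewrite -EFinM lee_fin -/(Rintegral P setT (g j)) RintegralZl//.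
  apply: le_trans (ler_wpM2l c0 (ES2 _)) _.
  rewrite /c natrX le_eqVlt; apply/orP; left; apply/eqP; field.
  by rewrite nat1r pnatr_eq0.
have Egs : (\int[P]_w (\sum_(0 <= j <oo) (g j w)%:E) < +oo)%E.
  rewrite integral_nneseries//; last 2 first.
  - by move=> j; apply/measurable_EFinP.
  - by move=> j w _; rewrite lee_fin.
  apply: (@le_lt_trans _ _ (\sum_(0 <= j <oo) ((M * M)%:E * ((j.+1%:R ^+ 2)^-1)%:E))%E).
    by apply: lee_nneseries => // j _ _; apply: integral_ge0 => w _; rewrite lee_fin.
  rewrite nneseriesZl; last by move=> j _; rewrite lee_fin invr_ge0 sqr_ge0.
  apply: le_lt_trans (ltry (M * M * 2)).
  by rewrite [leRHS]EFinM lee_wpmul2l ?nneseries_inv_sqr_le// lee_fin -expr2 sqr_ge0.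
have ig : P.-integrable setT (fun w => \sum_(0 <= j <oo) (g j w)%:E)%E.
  apply/integrableP; split.
    by apply: ge0_emeasurable_sum => [j w _ _|j _]; [rewrite lee_fin|apply/measurable_EFinP].
  under eq_integral => w _.
    rewrite gee0_abs; last by apply: nneseries_ge0 => j _ _; rewrite lee_fin.
    over.
  exact: Egs.
have := integrable_ae measurableT ig; apply: filterS => w /(_ I) gw.
have {}gw : g j w @[j --> \oo] --> (0 : R).
  apply: cvg_series_cvg_0; apply: nnseries_is_cvg => //.
  by rewrite -ge0_fin_numE//; apply: nneseries_ge0 => j _ _; rewrite lee_fin.
apply: (@mean_cvg0_of_squares _ (S ^~ w) M).
  by move=> k; rewrite SS addrAC subrr add0r.
apply/cvgr0Pnorm_le => e e0.
have e20 : 0 < e ^+ 2 by rewrite exprn_gt0.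
have [N _ Ng] := (@cvgr0Pnorm_le _ _ _ _ _ _).1 gw _ e20.
exists N.+1 => // -[//|j] Nj.
have := Ng j Nj; rewrite /= ger0_norm//.
have -> : g j w = `|S (j.+1 ^ 2)%N w / (j.+1 ^ 2)%:R| ^+ 2.
  by rewrite real_normK ?num_real// /g expr_div_n mulrC expr2.
by rewrite ler_pXn2r ?nnegrE// ltW.
Qed.


(** Pairwise independence makes the centred variables h(X_i) - m orthogonal. The function [h] allows
    a truncation that makes almost surely bounded variables bounded everywhere. *)
Lemma slln_bounded_iid (X : nat -> {RV P >-> R}) (h : R -> R) (M : R) :
  measurable_fun setT h -> (forall x, `|h x| <= M) ->
  (forall i j A B, i != j -> measurable A -> measurable B ->
    P (X i @^-1` A `&` X j @^-1` B) = P (X i @^-1` A) * P (X j @^-1` B))%E ->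
  (forall i A, measurable A -> P (X i @^-1` A) = P (X 0%N @^-1` A)) ->
  {ae P, forall w, (\sum_(k < n) h (X k w)) / n%:R @[n --> \oo] -->
    \int[P]_w h (X 0%N w)}.
Proof.
move=> mh hM indep ident.
have ih i : P.-integrable setT (EFin \o (h \o X i)).
  apply: (@bounded_integrable _ M); first exact: measurableT_comp.
  by move=> w; exact: hM.
set m := \int[P]_w h (X 0%N w).
have hE i : \int[P]_w h (X i w) = m.
  have mhE : measurable_fun setT (EFin \o h) by apply/measurable_EFinP.
  rewrite /m /Rintegral; congr fine.
  rewrite -(integral_distribution (X := X i) mhE (ih i)).
  rewrite -(integral_distribution (X := X 0%N) mhE (ih 0%N)).
  by apply: eq_measure_integral => A mA _; exact: ident.
have mD i : measurable_fun setT (fun w => h (X i w) - m).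
  by apply: measurable_funB => //; exact: measurableT_comp.
have DM i w : `|h (X i w) - m| <= M + `|m|.
  by apply: le_trans (ler_normB _ _) _; rewrite lerD2r.
have orth i j : i != j -> \int[P]_w ((h (X i w) - m) * (h (X j w) - m)) = 0.
  move=> ij.
  pose D k : {RV P >-> R} :=
    HB.pack (fun w => h (X k w) - m) (isMeasurableFun.Build _ _ _ _ _ (mD k)).
  have D0 k : \int[P]_w D k w = 0.
    have im : P.-integrable setT (EFin \o cst m).
      exact: (@bounded_integrable _ `|m|).
    rewrite (RintegralB measurableT (ih k) im) /= hE.
    rewrite Rintegral_cst// [fine _](_ : _ = 1) ?mulr1 ?subrr//.
    exact: (congr1 fine (probability_setT P)).
  rewrite (@Rintegral_prod_independent (D i) (D j) _ (DM i) (DM j)) ?D0 ?mulr0//.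
  move=> A B mA mB.
  have mhm : measurable_fun setT (fun x => h x - m) by apply: measurable_funB.
  have mpre C : measurable C -> measurable ((fun x => h x - m) @^-1` C).
    by move=> mC; rewrite -[_ @^-1` _]setTI; exact: mhm.
  exact: (indep _ _ _ _ ij (mpre _ mA) (mpre _ mB)).
have := slln_bounded_orthogonal mD DM orth; apply: filterS => w hw.
have : (\sum_(k < n) (h (X k w) - m)) / n%:R + m @[n --> \oo] --> 0 + m.
  by apply: cvgD => //; exact: cvg_cst.
rewrite add0r; apply: cvg_trans; apply: near_eq_cvg; near=> n.
have n0 : n%:R != 0 :> R by rewrite pnatr_eq0 -lt0n; near: n; exists 1%N.
by rewrite sumrB sumr_const card_ord -(mulr_natr m) mulrBl mulfK// subrK.
Unshelve. all: by end_near. Qed.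

End LawOfLargeNumbers.

(** * Passage from the i.i.d. vectors to almost every environment *)

Theorem theorem9 (R : realType) (d : measure_display) (T : measurableType d)
    (P : probability T R) (delta alpha : R) (xi Y : nat -> {RV P >-> R})
    (delta_gt0 : 0 < delta) (delta_lt_half : delta < 1 / 2)
    (alpha_gt0 : 0 < alpha)
    (xiY_iid : iid P [set i | (1 <= i)%N] (fun i w => (xi i w, Y i w)))
    (xi_elliptic : P [set w | delta <= xi 1%N w <= 1 - delta] = 1%E)
    (Y_bounded : forall w, -1 <= Y 1%N w <= 1)
    (xi_half : P [set w | xi 1%N w = 1 / 2] = 1%E)
    (EY_gt0 : (0 < 'E_P[Y 1%N])%E)
    (VY_gt0 : (0 < 'V_P[Y 1%N])%E) (VY_lty : ('V_P[Y 1%N] < +oo)%E)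
    (alpha_lt1 : alpha < 1) :
  {ae P, forall w, exists pi : nat -> R,
    unique (stationary_distribution
      (transition (environment delta alpha (xi ^~ w) (Y ^~ w)))) pi /\
    exists eps : nat -> R, eps n @[n --> \oo] --> (0 : R) /\
      \forall n \near \oo,
        pi n = expR (- (4 * fine 'E_P[Y 1%N] / (1 - alpha)
                        * n%:R `^ (1 - alpha) * (1 + eps n)))}.
Proof.
have [indep ident] := xiY_iid.
(* Only [Y 1] is bounded everywhere; truncating makes all the variables so. *)
pose h (x : R) := Num.max (-1) (Num.min 1 x).
have mh : measurable_fun setT h.
  by apply: measurable_maxr => //; exact: measurable_minr.
have h1 x : `|h x| <= 1.
  rewrite ler_norml /h le_max lexx /= ge_max ge_min lexx /= andbT; lra.
have hid x : -1 <= x <= 1 -> h x = x.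
  by move=> /andP[x1 x2]; rewrite /h (min_idPr x2) (max_idPr x1).
have EYE : ('E_P[Y 1%N] = (\int[P]_w h (Y 1%N w))%:E)%E.
  rewrite unlock /Rintegral fineK.
    by apply: eq_integral => w _; rewrite hid.
  apply: integrable_fin_num => //.
  apply: (@bounded_integrable _ _ _ P (h \o Y 1%N) 1); first exact: measurableT_comp.
  by move=> w; exact: h1.
have mu0 : 0 < \int[P]_w h (Y 1%N w) by rewrite -lte_fin -EYE.
(* Events of one coordinate are cylinder events of the pair, which transfers the i.i.d. hypothesis
   to each coordinate. *)
have preY i (A : set R) : Y i @^-1` A = (fun w => (xi i w, Y i w)) @^-1` (setT `*` A).
  by apply/seteqP; split => w //= -[].
have prexi i (A : set R) : xi i @^-1` A = (fun w => (xi i w, Y i w)) @^-1` (A `*` setT).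
  by apply/seteqP; split => w //= -[].
have identY i (A : set R) : (1 <= i)%N -> measurable A -> P (Y i @^-1` A) = P (Y 1%N @^-1` A).
  by move=> i1 mA; rewrite !preY; apply: ident => //; exact: measurableX.
have identxi i (A : set R) : (1 <= i)%N -> measurable A -> P (xi i @^-1` A) = P (xi 1%N @^-1` A).
  by move=> i1 mA; rewrite !prexi; apply: ident => //; exact: measurableX.
have indepY i j (A B : set R) : i != j -> measurable A -> measurable B ->
    (P (Y i.+1 @^-1` A `&` Y j.+1 @^-1` B) = P (Y i.+1 @^-1` A) * P (Y j.+1 @^-1` B))%E.
  move=> ij mA mB.
  (* Joint independence is used for two indices only; the conditional assigns [A] to one and [B] to
     the other. *)
  have := indep [:: i.+1; j.+1] (fun k => setT `*` (if k == i.+1 then A else B)).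
  rewrite /= inE eqSS ij => /(_ isT) /=.
  rewrite big_cons big_seq1 eqxx eqSS eq_sym (negbTE ij) -!preY => <-.
  - congr (P _); apply/seteqP; split => w /=.
      move=> [Aw Bw] k /=; rewrite !inE => /orP[|] /eqP ->.
        by rewrite eqxx.
      by rewrite eqSS eq_sym (negbTE ij).
    move=> hw; split.
      by have := hw i.+1; rewrite /= !inE eqxx => /(_ isT) [].
    have := hw j.+1; rewrite /= !inE eqxx orbT => /(_ isT) [] _.
    by rewrite eqSS eq_sym (negbTE ij).
  - by move=> k /=; rewrite !inE => /orP[|] /eqP ->.
  - by move=> k; apply: measurableX => //; case: ifP.
have ae_xi : {ae P, forall w n, (1 <= n)%N -> xi n w = 1 / 2}.
  apply: ae_forall_nat => n; case: n => [|n]; first exact: aeW.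
  have : {ae P, forall w, (xi n.+1 @^-1` [set 1 / 2]) w}.
    apply: probability1_ae; last by rewrite identxi.
    by rewrite -[_ @^-1` _]setTI; exact: measurable_funPT.
  by apply: filterS => w /= + _.
have ae_Y : {ae P, forall w n, (1 <= n)%N -> -1 <= Y n w <= 1}.
  apply: ae_forall_nat => n; case: n => [|n]; first exact: aeW.
  have : {ae P, forall w, (Y n.+1 @^-1` `[-1, 1]%classic) w}.
    apply: probability1_ae.
      by rewrite -[_ @^-1` _]setTI; exact: measurable_funPT.
    (* Equality in law carries the bound on [Y 1] over to every later index, almost surely. *)
    rewrite identY// [X in P X](_ : _ = setT) ?probability_setT//.
    by apply/seteqP; split => w //= _; rewrite in_itv /= Y_bounded.
  by apply: filterS => w /=; rewrite in_itv.
(* The shift drops [Y 0], which lies outside the i.i.d. family. *)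
have ae_slln := slln_bounded_iid (X := fun i => Y i.+1) mh h1 indepY
  (fun i A => identY i.+1 A isT).
move: ae_xi ae_Y ae_slln; apply: filterS3 => w xiw Yw sllnw.
rewrite EYE /=; apply: environment_stationary_distribution => //.
- by rewrite delta_gt0.
- by rewrite alpha_gt0.
- by move=> n n1; rewrite ler_norml Yw.
- move: sllnw; apply: cvg_trans; apply: near_eq_cvg; apply: nearW => n /=.
  by congr (_ / _); apply: eq_bigr => k _; rewrite hid// Yw.
Qed.
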